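(* In the finite-horizon purchasing problem described in the context, with $t_N<\infty$, the following three properties hold. (1) At any time point $t_n$ with $0\le t_n\le t_{N-1}$, there exists a finite price $x^H(t_n) := \theta - h_{t_{N-1}}/K$ for which any $x \ge x^H(t_n)$ satisfies $x + dt\sum_{i=n}^{N-1}h_{t_i} > V^C(x,t_n)$. (2) At any time point $t_n$ with $0\le t_n\le t_{N-1}$, there exists a finite price $$x^L(t_n) := \min\left\{\frac{b(t_{n+1})-\theta\, dt\, K}{1-dt\,K},\; \frac{\theta\, dt\, K-\sigma\sqrt{dt}-h_{t_n}dt}{dt\,K}\right\}$$ for which any $x\le x^L(t_n)$ satisfies $x+dt\sum_{i=n}^{N-1}h_{t_i} < V^C(x,t_n)$. (3) The function $x\mapsto V^C(x,t_n)$ is concave and increasing in $x$. Moreover, for $0\le t_n<t_N<\infty$ there exists a finite single threshold value $b(t_n)$, i.e. exactly one real number $b(t_n)$ with $V^C(b(t_n),t_n)=b(t_n)+dt\sum_{i=n}^{N-1}h_{t_i}$.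
   Context: Model. A single item must be purchased within a finite horizon $[0,T]$. Decisions are made on the grid $t_n = n\cdot dt$, $0\le n\le N$, with $dt>0$ and $N=T/dt$. The item's price follows the AR(1) process $X_t = \theta K\,dt + (1-K\,dt)X_{t-dt} + \sigma\varepsilon_t$, where $\theta\in\mathbb{R}$ is the long-run average price, $K$ is the reverting rate, $\sigma>0$ is the degree of volatility, $|1-K\,dt|<1$, and the $\varepsilon_{t_1},\varepsilon_{t_2},\dots$ are i.i.d. $N(0,dt)$. For $t_n<t_i$, $X_{t_n,t_i}(x)$ denotes the random price $X_{t_i}$ conditioned on $X_{t_n}=x$. Holding the item from $t_n$ to $t_N$ costs $dt\sum_{i=n}^{N-1}h_{t_i}$, where the holding costs per time unit $h_{t_0},\dots,h_{t_{N-1}}$ are weakly decreasing in time. Value function. $V(x,t_N)=x$ (the item must be bought at $t_N$ if not bought before), and for $0\le n<N$, $$V(x,t_n)=\min\Big\{V^C(x,t_n),\; x+dt\sum_{i=n}^{N-1}h_{t_i}\Big\},\qquad V^C(x,t_n)=E\big[V(X_{t_n,t_{n+1}}(x),t_{n+1})\big].$$ Here $V^C(x,t_n)$ is the expected total cost of waiting at time $t_n$ and continuing optimally, and $x+dt\sum_{i=n}^{N-1}h_{t_i}$ is the total cost of purchasing at time $t_n$ at price $x$. Threshold. A threshold value at time $t_n$, $0\le n\le N-1$, is a price $b(t_n)$ satisfying $V^C(b(t_n),t_n)=b(t_n)+dt\sum_{i=n}^{N-1}h_{t_i}$. By convention $b(t_N)=\infty$.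
   Formalization: In (1), the strict inequality is claimed except at t_n = t_{N-1}, x = x^H, where equality holds (only ≤ there). Property (2) and ''increasing'' (read as strictly increasing) in (3) are claimed only when 1 - K dt > 0, since they fail or are undefined for 1 - K dt ≤ 0. *)

(* Defs.v *)
From HB Require Import structures.
From mathcomp Require Import all_boot all_order all_algebra.
From mathcomp Require Import finmap.
From mathcomp Require Import all_classical all_reals all_analysis.
Set Implicit Arguments.
Unset Strict Implicit.
Unset Printing Implicit Defensive.
Import Order.TTheory GRing.Theory Num.Theory.
Import numFieldNormedType.Exports.
Local Open Scope classical_set_scope.
Local Open Scope ring_scope.

Definition mutually_independent d (Omega : measurableType d) (R : realType)
    (P : probability Omega R) (I : choiceType) (Y : I -> {RV P >-> R}) : Prop :=
  forall (J : {fset I}) (A : I -> set R), (forall i, measurable (A i)) ->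
    P (\bigcap_(i in [set` J]) (Y i @^-1` A i)) =
    (\prod_(i <- J) P (Y i @^-1` A i))%E.

Definition concave_function (R : realType) (f : R -> R) : Prop :=
  convex_function [set: convex_lmodType R^o] (fun x => - f x).

(* The grid point t_n = n * dt is represented by its index n; [noise i] is
   eps_{t_i} for 1 <= i ([noise 0] is never used), and [h i] is h_{t_i}.
   [normal_prob] takes the standard deviation as second parameter, so that
   N(0, dt) is [normal_prob 0 (Num.sqrt dt)]. *)
Record purchasing_problem d (Omega : measurableType d) (R : realType)
    (P : probability Omega R) := PurchasingProblem {
  horizon : R;
  dt : R;
  N : nat;
  theta : R;
  K : R;
  sigma : R;
  h : nat -> R;
  noise : nat -> {RV P >-> R};
  dt_gt0 : 0 < dt;
  N_def : N%:R = horizon / dt;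
  sigma_gt0 : 0 < sigma;
  mean_reverting : `|1 - K * dt| < 1;
  h_decr : forall i j, (i <= j < N)%N -> h j <= h i;
  noise_normal : forall i (A : set R), measurable A ->
    distribution P (noise i.+1) A = normal_prob 0 (Num.sqrt dt) A;
  noise_indep : mutually_independent (fun i => noise i.+1)
}.

Section Value.
Context d (Omega : measurableType d) (R : realType) (P : probability Omega R).
Variable M : purchasing_problem P.

(* X_{t_n,t_i}(x): the AR(1) recursion started from x at time t_n; it is
   constantly x for i <= n. *)
Fixpoint price (n i : nat) (x : R) (w : Omega) : R :=
  if i is j.+1 then
    if (n <= j)%N then
      theta M * K M * dt M + (1 - K M * dt M) * price n j x w
        + sigma M * noise M j.+1 w
    else x
  else x.

Definition purchase_cost (n : nat) (x : R) : R :=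
  x + dt M * \sum_(n <= i < N M) h M i.

(* The value function with k periods to go, that is, at time t_{N-k}. *)
Fixpoint value_to_go (k : nat) (x : R) : R :=
  if k is j.+1 then
    let n := (N M - j.+1)%N in
    Num.min (fine 'E_P[fun w => value_to_go j (price n n.+1 x w)])
            (purchase_cost n x)
  else x.

Definition V (n : nat) (x : R) : R := value_to_go (N M - n) x.

Definition VC (n : nat) (x : R) : R :=
  fine 'E_P[fun w => V n.+1 (price n n.+1 x w)].

Lemma V_terminal x : V (N M) x = x.
Proof. by rewrite /V subnn. Qed.

Lemma V_recursion n x : (n < N M)%N ->
  V n x = Num.min (VC n x) (purchase_cost n x).
Proof.
by move=> nN; rewrite /VC /V -(subnSK nN) /= subnSK// subKn// ltnW.
Qed.

Definition threshold (n : nat) (b : R) : Prop := VC n b = purchase_cost n b.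

(* Threshold values at t_0, ..., t_N, with b(t_N) = +oo. *)
Definition ext_threshold (n : nat) (b : \bar R) : Prop :=
  if (n < N M)%N then exists2 r, b = r%:E & threshold n r else b = +oo%E.

Definition xH : R := theta M - h M (N M).-1 / K M.

(* x^L(t_n), as a function of the (possibly infinite) threshold b(t_{n+1}). *)
Definition xL (n : nat) (b : \bar R) : \bar R :=
  Order.min
    ((b - (theta M * dt M * K M)%:E) * ((1 - dt M * K M)^-1)%:E)%E
    ((theta M * dt M * K M - sigma M * Num.sqrt (dt M) - h M n * dt M)
      / (dt M * K M))%:E.

End Value.

(* Main.v *)
(* Put a = 1 - K dt and T f x = E[f(theta K dt + a x + sigma e)], so that
   VC n = T (V n.+1). The minimum with the purchase cost preserves concavity and
   the Lipschitz constant 1, and T turns a 1-Lipschitz function into an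
   |a|-Lipschitz one. Hence VC n - purchase_cost n is continuous and decreases
   with slope at most -(1 - |a|) < 0, so it has exactly one zero, whatever the
   sign of a.
   For large prices, V n.+1 is at most the cost of purchasing at t_{n+1}; this
   is strict above xH when n+1 < N, and the normal law charges every half-line.
   For small prices, V n.+1 is nondecreasing and equals the purchase cost below
   the threshold b, so, if y <= b, V n.+1 (y + r) is at least the purchase cost
   at y minus the negative part of r; the negative part of N(0, s^2) has mean
   s / sqrt(2 pi) < s. *)

Require Import Defs.
From HB Require Import structures.
From mathcomp Require Import all_boot all_order all_algebra.
From mathcomp Require Import finmap.
From mathcomp Require Import all_classical all_reals all_analysis.
From mathcomp Require Import measurable_realfun ring lra.
Set Implicit Arguments.
Unset Strict Implicit.
Unset Printing Implicit Defensive.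
Import Order.TTheory GRing.Theory Num.Theory.
Import numFieldNormedType.Exports.
Local Open Scope classical_set_scope.
Local Open Scope ring_scope.

(** * Integrals against a normal law through its density *)

Section normal_law.
Context (R : realType) (m s : R).
Local Open Scope ereal_scope.
Local Notation mu := (@lebesgue_measure R).

(** The Radon-Nikodym derivative of the law and [normal_pdf] have the same integral over every
    measurable set, so they agree almost everywhere. *)
Lemma ge0_integral_normal_prob (f : measurableTypeR R -> \bar R) :
    (forall x, 0 <= f x) -> measurable_fun setT f ->
  \int[normal_prob m s]_x f x = \int[mu]_x (f x * (normal_pdf m s x)%:E).
Proof.
move=> f0 mf; have dom := normal_prob_dominates m s.
rewrite -(Radon_Nikodym_SigmaFinite.change_of_variables dom)//.
apply: ae_eq_integral => //.
- apply: emeasurable_funM => //; apply: measurable_int.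
  exact: Radon_Nikodym_SigmaFinite.f_integrable.
- apply: emeasurable_funM => //; apply/measurable_EFinP.
  exact: measurable_normal_pdf.
- apply: ae_eqe_mul2l; apply: integral_ae_eq => //.
  + exact: Radon_Nikodym_SigmaFinite.f_integrable.
  + by apply/measurable_EFinP; exact: measurable_normal_pdf.
  + by move=> A _ mA; rewrite -Radon_Nikodym_SigmaFinite.f_integral.
Qed.

End normal_law.

(** * Tails and half-means of a centered normal law *)

Section centered_normal_law.
Context (R : realType) (s : R).
Hypothesis s_gt0 : 0 < s.
Local Notation mu := (@lebesgue_measure R).
Local Notation p := (normal_pdf 0 s).

Lemma normal_pdf_even x : p (- x) = p x.
Proof. by rewrite normal_pdfE ?gt_eqF// /normal_fun !subr0 sqrrN. Qed.

(** The density is positive everywhere: a null half-line for the law would lie in a Lebesgue-null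
    set, yet its length is infinite. *)
Lemma normal_prob_gt_neq0 (t : R) : normal_prob 0 s `]t, +oo[ != 0%E.
Proof.
apply/eqP => p0.
have mp : measurable_fun `]t, +oo[ (EFin \o p).
  by apply/measurable_EFinP/measurable_funTS; exact: measurable_normal_pdf.
have : (\int[mu]_(x in `]t, +oo[) `|(EFin \o p) x| = 0)%E.
  rewrite -[RHS]p0; apply: eq_integral => x _ /=.
  by rewrite ger0_norm// normal_pdf_ge0.
move/(ae_eq_integral_abs mu (measurable_itv _) mp) => [A [mA muA sub]].
have : (mu `]t, +oo[ <= mu A)%E.
  apply: le_measure; rewrite ?inE//.
  apply: subset_trans sub => x /= tx /(_ tx) [px0].
  have : 0 < p x by rewrite normal_pdfE ?gt_eqF// mulr_gt0 ?expR_gt0//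
    normal_peak_gt0 ?gt_eqF.
  by rewrite px0 ltxx.
by rewrite muA lebesgue_measure_itv/= ltry.
Qed.

Lemma integral_normal_half_line :
  (\int[mu]_(x in `[0%R, +oo[) (x * p x)%:E = (s ^+ 2 * normal_peak s)%:E)%E.
Proof.
have s0 : s != 0 by rewrite gt_eqF.
(* This antiderivative is [- s ^+ 2] times the density, whose derivative at [x] is [- x / s ^+ 2]
   times itself. *)
pose F (x : R) := - (s ^+ 2 * normal_peak s) * expR (- x ^+ 2 / (s ^+ 2 *+ 2)).
have dF (x : R) : is_derive x 1 F (x * p x).
  rewrite /F; apply: is_derive_eq.
  rewrite normal_pdfE// /normal_fun subr0 !scaler1 /GRing.scale/=.
  by field.
have F0 : F 0 = - (s ^+ 2 * normal_peak s).
  by rewrite /F expr0n/= oppr0 mul0r expR0 mulr1.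
rewrite (@ge0_continuous_FTC2y _ _ F 0 0).
- by rewrite F0 -EFinB sub0r opprK.
- by move=> x x0; rewrite mulr_ge0// normal_pdf_ge0.
- apply: continuous_subspaceT => x; apply: cvgM; first exact: cvg_id.
  exact: continuous_normal_pdf.
- rewrite -[X in _ --> X](mulr0 (- (s ^+ 2 * normal_peak s))).
  apply: cvgM; first exact: cvg_cst.
  rewrite (_ : (fun x : R => _) =
    (fun z => expR (- z)) \o (fun x => x ^+ 2 * (s ^+ 2 *+ 2)^-1)); last first.
    by apply/funext => x /=; rewrite mulNr.
  apply: (@cvg_comp _ _ _ _ _ _ (pinfty_nbhs R)); last exact: cvgr_expR.
  apply: gt0_cvgMly; last exact: cvgr_expr2.
  by rewrite invr_gt0 pmulrn_lgt0// exprn_gt0.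
- by [].
- apply: cvg_at_right_filter.
  by apply: differentiable_continuous; apply/derivable1_diffP.
- by move=> x _; rewrite derive1E; apply: derive_val.
Qed.

Lemma integral_normal_pos :
  (\int[normal_prob 0 s]_x (Num.max x 0)%:E = (s ^+ 2 * normal_peak s)%:E)%E.
Proof.
rewrite ge0_integral_normal_prob; last 2 first.
- by move=> x; rewrite lee_fin le_max lexx orbT.
- by apply/measurable_EFinP; apply: measurable_maxr.
rewrite -integral_normal_half_line [RHS]integral_mkcond.
apply: eq_integral => x _; rewrite patchE -EFinM; case: ifPn.
  by rewrite inE/= in_itv/= andbT => /max_idPl ->.
rewrite notin_setE/= in_itv/= andbT => /negP; rewrite -ltNge => /ltW /max_idPr ->.
by rewrite mul0r.
Qed.

Lemma integral_normal_neg :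
  (\int[normal_prob 0 s]_x (Num.max (- x) 0)%:E = (s ^+ 2 * normal_peak s)%:E)%E.
Proof.
rewrite ge0_integral_normal_prob; last 2 first.
- by move=> x; rewrite lee_fin le_max lexx orbT.
- by apply/measurable_EFinP; apply: measurable_maxr => //; exact: oppr_measurable.
rewrite -integral_normal_half_line.
(* The end point is written [- 0] to fit the substitution of [- x] for [x]. *)
transitivity (\int[mu]_(x in `]-oo, (- 0)%R]) (- x * p x)%:E)%E.
  rewrite [RHS]integral_mkcond oppr0.
  apply: eq_integral => x _; rewrite patchE -EFinM; case: ifPn.
    by rewrite inE/= in_itv/= -oppr_ge0 => /max_idPl ->.
  rewrite notin_setE/= in_itv/= => /negP; rewrite -ltNge -oppr_lt0 => /ltW.
  by move=> /max_idPr ->; rewrite mul0r.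
rewrite (@ge0_integration_by_substitutionNy _ (fun x : R => - x * p x)).
- by apply: eq_integral => x _ /=; rewrite opprK normal_pdf_even.
- apply: continuous_subspaceT => x; apply: cvgM.
    by apply: cvgN; exact: cvg_id.
  by apply: continuous_normal_pdf; rewrite gt_eqF.
- move=> x; rewrite in_itv/= oppr0 => x0.
  by rewrite mulr_ge0 ?normal_pdf_ge0// oppr_ge0 ltW.
Qed.

(** The left side is [s] divided by the square root of 2 pi, and 2 pi exceeds 1. *)
Lemma normal_peak_mul_lt : s ^+ 2 * normal_peak s < s.
Proof.
rewrite /normal_peak -mulrnAr sqrtrM ?sqr_ge0// sqrtr_sqr gtr0_norm//.
rewrite invfM mulrA expr2 mulfK ?gt_eqF// -[ltRHS]mulr1 ltr_pM2l//.
have pi2 : 1 < (pi : R) *+ 2 by have := pi_ge2 R; rewrite -mulr_natl; lra.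
rewrite invf_lt1 ?sqrtr_gt0 ?(lt_trans ltr01)//.
by rewrite -[ltLHS]sqrtr1 ltr_sqrt// (lt_trans ltr01).
Qed.

End centered_normal_law.

(** * Random variables with a centered normal law *)

Section normal_noise.
Context d (Omega : measurableType d) (R : realType) (P : probability Omega R).
Variables (s : R) (e : {RV P >-> R}).
Hypothesis s_gt0 : 0 < s.
Hypothesis e_normal : forall A : set R, measurable A ->
  distribution P e A = normal_prob 0 s A.

Lemma normal_noise_gt_neq0 (t : R) : P [set w | t < e w] != 0%E.
Proof.
have -> : [set w | t < e w] = e @^-1` `]t, +oo[.
  by apply/seteqP; split=> w /=; rewrite in_itv/= andbT.
rewrite -[P _]/(distribution P e _) e_normal//.
exact: normal_prob_gt_neq0.
Qed.

Lemma ge0_integral_normal_noise (f : R -> R) : (forall x, 0 <= f x) ->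
  measurable_fun setT f ->
  (\int[P]_w (f (e w))%:E = \int[normal_prob 0 s]_x (f x)%:E)%E.
Proof.
move=> f0 mf.
rewrite -(@ge0_integral_distribution _ _ _ _ _ P e (EFin \o f)).
(* [distribution P e] lives on [R] and [normal_prob 0 s] on [measurableTypeR R]:
   they carry the same measurable sets under distinct displays, hence the
   transfer through the identity. *)
- pose idR (x : measurableTypeR R) : R := x.
  have mid : measurable_fun setT idR by exact: measurable_id.
  rewrite -[RHS](@ge0_integral_pushforward _ _ _ _ _ idR mid (normal_prob 0 s)
    setT (EFin \o f)) //.
  - by apply: eq_measure_integral => A mA _; exact: e_normal.
  - exact/measurable_EFinP.
  - by move=> y _; rewrite lee_fin.
- exact/measurable_EFinP.
- by move=> y; rewrite lee_fin.
Qed.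

Let mpos : measurable_fun [set: R] (fun x : R => Num.max x 0).
Proof. exact: measurable_maxr. Qed.

Let mneg : measurable_fun [set: R] (fun x : R => Num.max (- x) 0).
Proof. by apply: measurable_maxr => //; exact: oppr_measurable. Qed.

Let integrable_part (f : R -> R) (l : R) : (forall x, 0 <= f x) ->
  measurable_fun setT f ->
  (\int[normal_prob 0 s]_x (f x)%:E = l%:E)%E ->
  P.-integrable [set: Omega] (EFin \o (fun w => f (e w))).
Proof.
move=> f0 mf fl; apply/integrableP; split.
  by apply/measurable_EFinP; apply: measurableT_comp.
under eq_integral do rewrite /= ger0_norm//.
by rewrite ge0_integral_normal_noise// fl ltry.
Qed.

Lemma integrable_normal_noise_neg :
  P.-integrable [set: Omega] (EFin \o (fun w => Num.max (- e w) 0)).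
Proof.
apply: (integrable_part _ mneg (integral_normal_neg s_gt0)) => x.
by rewrite le_max lexx orbT.
Qed.

Let integrable_pos :
  P.-integrable [set: Omega] (EFin \o (fun w => Num.max (e w) 0)).
Proof.
apply: (integrable_part _ mpos (integral_normal_pos s_gt0)) => x.
by rewrite le_max lexx orbT.
Qed.

Lemma Rintegral_normal_noise_neg :
  \int[P]_w Num.max (- e w) 0 = s ^+ 2 * normal_peak s.
Proof.
rewrite /Rintegral (ge0_integral_normal_noise _ mneg) ?integral_normal_neg//.
by move=> x; rewrite le_max lexx orbT.
Qed.

(** The transfer to the normal law covers non-negative functions, so integrability and the mean of
    [e] go through its two parts; their means coincide and cancel. *)
Let posBneg : (e : Omega -> R) = (fun w => Num.max (e w) 0 - Num.max (- e w) 0).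
Proof.
apply/funext => w; case/orP: (le_total 0 (e w)) => e0.
  by rewrite max_l// max_r ?subr0// oppr_le0.
by rewrite max_r// max_l ?oppr_ge0// sub0r opprK.
Qed.

Lemma integrable_normal_noise : P.-integrable [set: Omega] (EFin \o e).
Proof.
rewrite posBneg.
exact: (integrableB measurableT integrable_pos integrable_normal_noise_neg).
Qed.

Lemma Rintegral_normal_noise : \int[P]_w e w = 0.
Proof.
rewrite posBneg RintegralB// ?Rintegral_normal_noise_neg.
- rewrite /Rintegral (ge0_integral_normal_noise _ mpos) ?integral_normal_pos//.
    by rewrite subrr.
  by move=> x; rewrite le_max lexx orbT.
- exact: integrable_normal_noise_neg.
Qed.

Lemma Rintegral_normal_noise_neg_lt : \int[P]_w Num.max (- e w) 0 < s.
Proof. by rewrite Rintegral_normal_noise_neg normal_peak_mul_lt. Qed.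

End normal_noise.

(** * Strict monotonicity of the integral *)

Section strict_integral.
Context d (T : measurableType d) (R : realType) (P : probability T R).

(** If the integrals were equal, the non-negative function [g - f] would vanish almost everywhere,
    but it is positive on the non-null set [A]. *)
Lemma lt_Rintegral (A : set T) (f g : T -> R) :
  measurable A -> P A != 0%E ->
  P.-integrable [set: T] (EFin \o f) -> P.-integrable [set: T] (EFin \o g) ->
  (forall w, f w <= g w) -> (forall w, A w -> f w < g w) ->
  \int[P]_w f w < \int[P]_w g w.
Proof.
move=> mA PA fint gint fg fgA; rewrite lt_neqAle le_Rintegral// andbT.
apply: contraNneq PA => eqfg; apply/eqP.
have gfint : P.-integrable [set: T] (EFin \o (fun w => g w - f w)).
  exact: (integrableB measurableT gint fint).
have : (\int[P]_(w in setT) `|(EFin \o (fun w => g w - f w)%R) w| = 0)%E.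
  under eq_integral do rewrite /= ger0_norm ?subr_ge0//.
  rewrite -[LHS]fineK; last exact: (integrable_fin_num measurableT gfint).
  by rewrite -/(Rintegral _ _ _) RintegralB// eqfg subrr.
have mgf := measurable_int _ gfint.
move/(ae_eq_integral_abs P measurableT mgf) => [N [mN PN sub]].
apply: (subset_measure0 mA mN _ PN); apply: subset_trans sub => w Aw /= /(_ I) [].
by move=> /eqP; rewrite subr_eq0 gt_eqF// fgA.
Qed.

End strict_integral.

(** * Concave and 1-Lipschitz functions on the line *)

Lemma concave_functionP (R : realType) (f : R -> R) :
  concave_function f <->
  forall (t : {i01 R}) (x y : R),
    t%:num * f x + (1 - t%:num) * f y <= f (t%:num * x + (1 - t%:num) * y).
Proof.
split=> [cf t x y|cf t x y _ _].
  have /= := cf t x y (mem_set I) (mem_set I).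
  by rewrite !convRE ?/onem !mulrN -opprD lerN2.
by rewrite !convRE ?/onem !mulrN -opprD lerN2; exact: cf.
Qed.

Section nonexpansive.
Context (R : realType).
Implicit Types f g : R -> R.

(** The regularity carried through the backward recursion: it yields measurability, integrability
    under the noise, and continuity. *)
Definition nonexpansive f := forall x y, `|f x - f y| <= `|x - y|.

Lemma nonexpansive_le f x y : nonexpansive f -> f x <= f y + `|x - y|.
Proof. by move=> /(_ x y) /(le_trans (ler_norm _)); rewrite lerBlDl. Qed.

Lemma nonexpansiveP f : (forall x y, f x <= f y + `|x - y|) -> nonexpansive f.
Proof.
move=> fle x y; rewrite ler_norml lerBlDl fle andbT.
by rewrite lerBrDl lerBlDr distrC fle.
Qed.

Lemma nonexpansive_min f g : nonexpansive f -> nonexpansive g ->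
  nonexpansive (fun x => Num.min (f x) (g x)).
Proof.
move=> fl gl; apply: nonexpansiveP => x y.
rewrite addr_minl le_min !ge_min.
by rewrite (nonexpansive_le _ _ fl) (nonexpansive_le _ _ gl) orbT.
Qed.

Lemma nonexpansive_continuous f : nonexpansive f -> continuous f.
Proof.
move=> fl x; apply/cvgrPdist_le => eps eps0; near=> y.
by apply: le_trans (fl x y) _; near: y; exact: cvgr_dist_le.
Unshelve. all: by end_near. Qed.

End nonexpansive.

(** * The one-step expectation operator *)

Section bellman_operator.
Context d (Omega : measurableType d) (R : realType) (P : probability Omega R).
Variables (c a sg : R) (e : {RV P >-> R}).
Hypothesis sg_gt0 : 0 < sg.
Hypothesis e_int : P.-integrable [set: Omega] (EFin \o e).
Hypothesis e_mean : \int[P]_w e w = 0.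
Implicit Types f g : R -> R.

Definition next_expectation f x := \int[P]_w f (c + a * x + sg * e w).

Let noise_int : P.-integrable [set: Omega] (EFin \o (fun w => sg * e w)).
Proof. exact: (integrableZl measurableT sg e_int). Qed.

Let cst_int (m : R) : P.-integrable [set: Omega] (EFin \o (fun=> m)).
Proof. exact: finite_measure_integrable_cst. Qed.

Lemma integrable_affine (m : R) :
  P.-integrable [set: Omega] (EFin \o (fun w => m + sg * e w)).
Proof. exact: (integrableD measurableT (cst_int m) noise_int). Qed.

Lemma Rintegral_prob_cst (m : R) : \int[P]_w m = m.
Proof. by rewrite /Rintegral integral_cst//= probability_setT mule1. Qed.

(** A 1-Lipschitz [f] grows at most linearly: the integrand is dominated by [|f m| + |sg * e|]. *)
Lemma integrable_nonexpansive f m : nonexpansive f ->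
  P.-integrable [set: Omega] (EFin \o (fun w => f (m + sg * e w))).
Proof.
move=> fl.
have int_norm : P.-integrable [set: Omega]
    (EFin \o (fun w => `|f m| + `|sg * e w|)).
  exact: (integrableD measurableT (cst_int _) (integrable_norm noise_int)).
apply: le_integrable int_norm => //.
  apply/measurable_EFinP; apply: (measurableT_comp (f := f)).
    exact: continuous_measurable_fun (nonexpansive_continuous fl).
  exact/measurable_EFinP/(measurable_int P)/integrable_affine.
move=> w _; rewrite lee_fin /= [leRHS]ger0_norm ?addr_ge0//.
have /= := fl (m + sg * e w) m; rewrite addrAC subrr add0r => fle.
by rewrite -lerBlDl (le_trans _ fle)// lerB_dist.
Qed.

Lemma next_expectation_affine m x :
  next_expectation (fun y => y + m) x = c + a * x + m.
Proof.
rewrite /next_expectation.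
under eq_Rintegral do rewrite addrAC.
rewrite RintegralD//.
by rewrite RintegralZl// e_mean mulr0 addr0 Rintegral_prob_cst.
Qed.

Lemma next_expectation_le f g x : nonexpansive f -> nonexpansive g ->
  (forall y, f y <= g y) -> next_expectation f x <= next_expectation g x.
Proof.
by move=> fl gl fg; apply: le_Rintegral => //; exact: integrable_nonexpansive.
Qed.

Lemma next_expectation_lt f g x t : nonexpansive f -> nonexpansive g ->
  (forall r, P [set w | r < e w] != 0%E) ->
  (forall y, f y <= g y) -> (forall y, t < y -> f y < g y) ->
  next_expectation f x < next_expectation g x.
Proof.
(* Noise above [r] is exactly what carries the next price above [t]. *)
move=> fl gl tail fg fgt; pose r := (t - (c + a * x)) / sg.
apply: (lt_Rintegral (A := [set w | r < e w])).
- rewrite (_ : [set w | _] = e @^-1` `]r, +oo[).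
    exact: measurable_funPTI.
  by apply/seteqP; split=> w /=; rewrite in_itv/= andbT.
- exact: tail.
- exact: integrable_nonexpansive.
- exact: integrable_nonexpansive.
- by move=> w; exact: fg.
- by move=> w /=; rewrite ltr_pdivrMr// ltrBlDl [_ * sg]mulrC => lt_t; exact: fgt.
Qed.

(** Under the same noise, the next prices from [x] and [y] differ by exactly [a * (x - y)]. *)
Lemma next_expectation_lipschitz f x y : nonexpansive f ->
  next_expectation f x <= next_expectation f y + `|a| * `|x - y|.
Proof.
move=> fl; rewrite -[X in _ + X]Rintegral_prob_cst -RintegralD//; last first.
  exact: integrable_nonexpansive.
apply: le_Rintegral => //; first exact: integrable_nonexpansive.
  exact: (integrableD measurableT (integrable_nonexpansive _ fl) (cst_int _)).
move=> w _; rewrite (le_trans (nonexpansive_le _ (c + a * y + sg * e w) fl))//.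
by rewrite lerD2l -normrM le_eqVlt; apply/orP; left; apply/eqP; congr `|_|; ring.
Qed.

Lemma next_expectation_concave f : nonexpansive f -> concave_function f ->
  concave_function (next_expectation f).
Proof.
move=> fl /concave_functionP cf; apply/concave_functionP => t x y.
have fint m := integrable_nonexpansive m fl.
have tint r m := integrableZl measurableT r (fint m).
rewrite -!RintegralZl// -RintegralD//; last 2 first.
- exact: tint.
- exact: tint.
apply: le_Rintegral => //.
  exact: (integrableD measurableT (tint _ _) (tint _ _)).
move=> w _; apply: le_trans (cf t _ _) _.
rewrite le_eqVlt; apply/orP; left; apply/eqP; congr f.
by ring.
Qed.

Lemma next_expectation_homo f : 0 < a -> nonexpansive f ->
  {homo f : x y / x < y} -> {homo next_expectation f : x y / x < y}.
Proof.
move=> a0 fl fh x y xy.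
apply: (lt_Rintegral (A := setT)) => //.
- by rewrite probability_setT oner_neq0.
- exact: integrable_nonexpansive.
- exact: integrable_nonexpansive.
- by move=> w; apply/ltW/fh; rewrite ltrD2r ltrD2l ltr_pM2l.
- by move=> w _; apply/fh; rewrite ltrD2r ltrD2l ltr_pM2l.
Qed.

Lemma next_expectation_ge f m x :
  P.-integrable [set: Omega] (EFin \o (fun w => Num.max (- e w) 0)) ->
  nonexpansive f ->
  (forall r, c + a * x + m - Num.max (- r) 0 <= f (c + a * x + r)) ->
  c + a * x + m - sg * \int[P]_w Num.max (- e w) 0 <= next_expectation f x.
Proof.
move=> nint fl fge.
have nint' := integrableZl measurableT sg nint.
rewrite -RintegralZl// -[X in X - _]Rintegral_prob_cst -RintegralB//.
apply: le_Rintegral => //.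
- exact: (integrableB measurableT (cst_int _) nint').
- exact: integrable_nonexpansive.
- by move=> w _; rewrite maxr_pMr ?(ltW sg_gt0)// mulr0 mulrN; exact: fge.
Qed.

End bellman_operator.

Lemma downward_ind (m : nat) (Q : nat -> Prop) :
  (forall n, (m <= n)%N -> Q n) -> (forall n, (n < m)%N -> Q n.+1 -> Q n) ->
  forall n, Q n.
Proof.
move=> Qm QS n; have [k] := ubnP (m - n); elim: k n => // k IH n mn.
have [|nm] := leqP m n; first exact: Qm.
apply: QS => //; apply: IH; rewrite subnS.
by case: (m - n)%N (subn_gt0 n m) mn => //; rewrite nm.
Qed.

(** * Regularity of the value function by backward induction *)

Section purchasing.
Context d (Omega : measurableType d) (R : realType) (P : probability Omega R).
Variable M : purchasing_problem P.

Let c := theta M * K M * dt M.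
Let a := 1 - K M * dt M.
Let H n := dt M * \sum_(n <= i < N M) h M i.
Let s := Num.sqrt (dt M).

Let s_gt0 : 0 < s. Proof. by rewrite sqrtr_gt0 dt_gt0. Qed.

Lemma reversion_gt0 : 0 < K M * dt M.
Proof. by have := mean_reverting M; rewrite ltr_norml => /andP[_]; lra. Qed.

Lemma reverting_rate_gt0 : 0 < K M.
Proof. by have := reversion_gt0; rewrite pmulr_lgt0 ?dt_gt0. Qed.

Lemma price_refl n x w : price M n n x w = x.
Proof. by case: n => //= n; rewrite ltnn. Qed.

Lemma VC_next_expectation n :
  VC M n = next_expectation c a (sigma M) (noise M n.+1) (V M n.+1).
Proof.
apply/funext => x; rewrite /VC /next_expectation unlock; congr fine.
by apply: eq_integral => w _; rewrite /= leqnn price_refl.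
Qed.

Let e_int n := integrable_normal_noise s_gt0 (noise_normal M n).
Let e_mean n := Rintegral_normal_noise s_gt0 (noise_normal M n).
Let sg_gt0 := sigma_gt0 M.

(** Truncated subtraction leaves zero periods to go from [N] onward; this is the base case of the
    backward inductions. *)
Lemma V_id n : (N M <= n)%N -> V M n = id.
Proof. by rewrite -subn_eq0 /V => /eqP ->. Qed.

Lemma V_min n : (n < N M)%N ->
  V M n = fun x => Num.min (VC M n x) (purchase_cost M n x).
Proof. by move=> nN; apply/funext => x; rewrite V_recursion. Qed.

Lemma holding_cost_recl n : (n < N M)%N -> H n = dt M * h M n + H n.+1.
Proof. by move=> nN; rewrite /H big_ltn// mulrDr. Qed.

Lemma V_le_purchase n x : V M n x <= x + H n.
Proof.
have [Nn|nN] := leqP (N M) n.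
  by rewrite V_id// /H big_geq// mulr0 addr0.
by rewrite V_min// ge_min lexx orbT.
Qed.

Lemma nonexpansive_addr (m : R) : nonexpansive (fun x => x + m).
Proof. by move=> x y; rewrite opprD addrACA subrr addr0. Qed.

(** Regularity of [V] at the next time is a hypothesis here, because this bound serves inside the
    induction that proves it. *)
Lemma VC_lipschitz_of n x y : nonexpansive (V M n.+1) ->
  VC M n x <= VC M n y + `|a| * `|x - y|.
Proof. by rewrite VC_next_expectation; exact: next_expectation_lipschitz. Qed.

Lemma nonexpansive_V n : nonexpansive (V M n).
Proof.
move: n; apply: (downward_ind (m := N M)) => n nN; first by rewrite V_id.
move=> Vn; rewrite V_min//.
apply: nonexpansive_min; last exact: nonexpansive_addr.
apply: nonexpansiveP => x y; apply: le_trans (VC_lipschitz_of x y Vn) _.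
by rewrite lerD2l ler_piMl// ltW// mean_reverting.
Qed.

Lemma VC_lipschitz n x y : VC M n x <= VC M n y + `|a| * `|x - y|.
Proof. exact/VC_lipschitz_of/nonexpansive_V. Qed.

Lemma concave_function_V n : concave_function (V M n).
Proof.
move: n; apply: (downward_ind (m := N M)) => n nN.
  by rewrite V_id//; apply/concave_functionP => t x y.
move=> cV; have /concave_functionP cVC : concave_function (VC M n).
  by rewrite VC_next_expectation; apply: next_expectation_concave => //;
    exact: nonexpansive_V.
rewrite V_min//; apply/concave_functionP => t x y.
(* The minimum at each end point is at most either of its arguments, so concavity of both arguments
   passes to it. *)
rewrite le_min; apply/andP; split.
  apply: le_trans (cVC t x y); apply: lerD; apply: ler_wpM2l; rewrite ?subr_ge0//;
    by rewrite ge_min lexx.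
apply: (@le_trans _ _ (t%:num * purchase_cost M n x +
    (1 - t%:num) * purchase_cost M n y)).
  apply: lerD; apply: ler_wpM2l; rewrite ?subr_ge0//;
    by rewrite ge_min lexx orbT.
by rewrite le_eqVlt /purchase_cost; apply/orP; left; apply/eqP; ring.
Qed.

Lemma concave_function_VC n : concave_function (VC M n).
Proof.
rewrite VC_next_expectation; apply: next_expectation_concave => //.
  exact: nonexpansive_V.
exact: concave_function_V.
Qed.

Section positive_coefficient.
Hypothesis a_gt0 : 0 < a.

(** A positive [a] makes the next price increase with the current one under the same noise. With
    [a < 0], already the last continuation cost, [c + a * x], would decrease. *)
Lemma V_homo n : {homo V M n : x y / x < y}.
Proof.
move: n; apply: (downward_ind (m := N M)) => n nN; first by rewrite V_id.
move=> hV x y xy; rewrite V_min// lt_min !gt_min.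
have -> : VC M n x < VC M n y.
  rewrite VC_next_expectation; apply: next_expectation_homo => //.
  exact: nonexpansive_V.
by rewrite ltrD2r xy orbT.
Qed.

Lemma VC_homo n : {homo VC M n : x y / x < y}.
Proof.
rewrite VC_next_expectation; apply: next_expectation_homo => //.
  exact: nonexpansive_V.
exact: V_homo.
Qed.

End positive_coefficient.

(** * Thresholds as zeros of the excess cost of waiting *)

Let gap n x := VC M n x - purchase_cost M n x.

(** The continuation cost rises at rate at most [|a|], the purchase cost at rate 1. *)
Lemma gap_decr n x y : x <= y -> gap n y <= gap n x - (1 - `|a|) * (y - x).
Proof.
move=> xy; have := VC_lipschitz n y x; rewrite [X in _ * X]ger0_norm ?subr_ge0//.
rewrite /gap /purchase_cost; lra.
Qed.

Lemma gap_decr_lt n x y : x < y -> gap n y < gap n x.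
Proof.
move=> xy; apply: le_lt_trans (gap_decr n (ltW xy)) _.
by rewrite ltrBlDr ltrDl mulr_gt0// subr_gt0// mean_reverting.
Qed.

Lemma gap_continuous n : continuous (gap n).
Proof.
move=> x; apply: cvgB; last by apply: cvgD; [exact: cvg_id|exact: cvg_cst].
apply: nonexpansive_continuous; apply: nonexpansiveP => {}x y.
apply: le_trans (VC_lipschitz n x y) _.
by rewrite lerD2l ler_piMl// ltW// mean_reverting.
Qed.

Lemma threshold_gap n b : threshold M n b <-> gap n b = 0.
Proof.
by rewrite /threshold /gap; split=> [->|/eqP]; rewrite ?subrr// subr_eq0 => /eqP.
Qed.

Lemma threshold_unique n : exists! b, threshold M n b.
Proof.
have a1 : 0 < 1 - `|a| by rewrite subr_gt0 mean_reverting.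
(* Over a distance [r], a fall at rate [1 - |a|] offsets the value at 0, so a zero lies between
   [- r] and [r]. *)
pose r := `|gap n 0| / (1 - `|a|).
have r0 : 0 <= r by rewrite divr_ge0// ltW.
have ar : (1 - `|a|) * r = `|gap n 0| by rewrite mulrC divfK// gt_eqF.
have gr : gap n r <= 0.
  apply: le_trans (gap_decr n r0) _; rewrite subr0 ar subr_le0; exact: ler_norm.
have gNr : 0 <= gap n (- r).
  have r0' : - r <= 0 by rewrite oppr_le0.
  have := gap_decr n r0'; rewrite sub0r opprK ar.
  have := ler_norm (- gap n 0); rewrite normrN; lra.
have [|||b _ gb] := @IVT R (gap n) (- r) r 0.
- by rewrite ge0_cp.
- exact/continuous_subspaceT/gap_continuous.
- by rewrite ge_min le_max gr gNr orbT.
exists b; split; first exact/threshold_gap.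
move=> b' /threshold_gap gb'; case: (ltgtP b b') => // /(gap_decr_lt n).
  by rewrite gb gb' ltxx.
by rewrite gb gb' ltxx.
Qed.

(** * High prices: waiting beats purchasing *)

Lemma next_purchase_le n x : (n < N M)%N -> xH M <= x ->
  c + a * x + H n.+1 <= purchase_cost M n x.
Proof.
move=> nN; have K0 := reverting_rate_gt0; have dt0 := dt_gt0 M.
(* Waiting one step changes the expected price by [K dt (theta - x)] and saves [dt * h n] of
   holding. Above [xH] the change is at most [dt] times the last holding cost, the smallest one. *)
rewrite /xH lerBlDr -lerBlDl ler_pdivlMr// => xK.
have hn : h M (N M).-1 <= h M n.
  by apply: h_decr; rewrite -ltnS (ltn_predK nN) nN/=.
have : dt M * ((theta M - x) * K M) <= dt M * h M n.
  by rewrite ler_pM2l// (le_trans xK).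
by rewrite /purchase_cost -/(H n) (holding_cost_recl nN) /c /a; lra.
Qed.

Lemma next_purchase_lt n x : (n < N M)%N -> xH M < x ->
  c + a * x + H n.+1 < purchase_cost M n x.
Proof.
(* The weak inequality at [y] becomes strict at [x], since the two sides have slopes [a] and 1 with
   [1 - a = K dt > 0]. *)
move=> nN xHx; pose y := (xH M + x) / 2.
have yx : y < x by rewrite /y; lra.
have : xH M <= y by rewrite /y; lra.
move=> /(next_purchase_le nN).
have : 0 < (1 - a) * (x - y).
  by rewrite mulr_gt0 ?subr_gt0// /a; have := reversion_gt0; lra.
rewrite /purchase_cost; lra.
Qed.

(** The right side is the expected cost of surely buying at the next time, which optimal
    continuation cannot exceed. *)
Lemma VC_le_next_purchase n x : VC M n x <= c + a * x + H n.+1.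
Proof.
rewrite VC_next_expectation.
rewrite -(next_expectation_affine c a (sigma M) (e_int n) (e_mean n)).
apply: next_expectation_le => //; first exact: nonexpansive_V.
  exact: nonexpansive_addr.
exact: V_le_purchase.
Qed.

(** With a decision left at the next time, the next price exceeds [xH] with positive probability,
    and there waiting again is strictly cheaper. *)
Lemma VC_lt_next_purchase n x : (n.+1 < N M)%N -> VC M n x < c + a * x + H n.+1.
Proof.
move=> nN.
rewrite VC_next_expectation.
rewrite -(next_expectation_affine c a (sigma M) (e_int n) (e_mean n)).
apply: (next_expectation_lt _ _ _ _ _ (t := xH M)) => //.
- exact: nonexpansive_V.
- exact: nonexpansive_addr.
- exact: (normal_noise_gt_neq0 s_gt0 (noise_normal M n)).
- exact: V_le_purchase.
- move=> y xHy; rewrite V_min// gt_min; apply/orP; left.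
  exact: le_lt_trans (VC_le_next_purchase _ _) (next_purchase_lt nN xHy).
Qed.

(** * Low prices: purchasing beats waiting *)

Lemma V_ge_threshold n b y r : 0 < a -> (n <= N M)%N -> ext_threshold M n b ->
  (y%:E <= b)%E -> y + H n - Num.max (- r) 0 <= V M n (y + r).
Proof.
move=> a0 nN; rewrite /ext_threshold; case: ltnP => [{}nN|Nn ->].
  move=> [b' -> /threshold_gap gb]; rewrite lee_fin => yb.
  (* Below the threshold the gap is non-negative, so the purchase cost attains the minimum. Positive
     [r] is then handled by monotonicity of [V]. *)
  have Vlow z : z <= b' -> z + H n <= V M n z.
    move=> zb; rewrite V_min// le_min lexx andbT.
    have : 0 <= gap n z.
      move: zb; rewrite le_eqVlt => /predU1P[->|/(gap_decr_lt n)].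
        by rewrite gb.
      by rewrite gb => /ltW.
    by rewrite subr_ge0.
  have Vmono u v : u <= v -> V M n u <= V M n v.
    exact: (ltW_homo (V_homo a0 n)).
  have [r0|r0] := leP r 0.
    rewrite max_l ?oppr_ge0// opprK addrAC; apply: Vlow.
    by rewrite (le_trans _ yb)// gerDl.
  rewrite max_r ?oppr_le0 ?(ltW r0)// subr0; apply: le_trans (Vlow _ yb) _.
  by apply: Vmono; rewrite lerDl ltW.
(* At [N] the value is the price itself, and any [r] is at least minus its negative part. *)
move=> _; rewrite V_id// /H big_geq// mulr0 addr0 lerD2l.
by rewrite lerNl le_max lexx.
Qed.

(** The hypotheses on [x] are the two entries of [xL] without denominators. The term [sigma M * s]
    strictly exceeds the expected loss from downward noise, hence the strict conclusion. *)
Lemma VC_gt_purchase n b x : 0 < a -> (n < N M)%N -> ext_threshold M n.+1 b ->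
  ((c + a * x)%:E <= b)%E ->
  x * (K M * dt M) <= c - sigma M * s - h M n * dt M ->
  purchase_cost M n x < VC M n x.
Proof.
move=> a0 nN thr cb xK.
have := @next_expectation_ge _ _ _ P c a (sigma M) (noise M n.+1) sg_gt0 (e_int n)
  (V M n.+1) (H n.+1) x (integrable_normal_noise_neg s_gt0 (noise_normal M n))
  (nonexpansive_V n.+1) (fun r => V_ge_threshold r a0 nN thr cb).
rewrite -VC_next_expectation; apply: lt_le_trans.
have := Rintegral_normal_noise_neg_lt s_gt0 (noise_normal M n).
rewrite -(ltr_pM2l sg_gt0) /purchase_cost -/(H n) (holding_cost_recl nN).
by move: xK; rewrite /a; lra.
Qed.

End purchasing.

Theorem lemma1 (d : measure_display) (Omega : measurableType d) (R : realType)
    (P : probability Omega R) (M : purchasing_problem P) :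
  [/\ (* strictness fails for n = N-1 and x = xH, where equality holds *)
      (forall n : nat, (n < N M)%N -> forall x : R, xH M <= x ->
        VC M n x <= purchase_cost M n x /\
        ((n.+1 < N M)%N \/ x <> xH M -> VC M n x < purchase_cost M n x)),
      (0 < 1 - K M * dt M ->
        forall n : nat, (n < N M)%N ->
        forall b : \bar R, ext_threshold M n.+1 b ->
          xL M n b \is a fin_num /\
          (forall x : R, (x%:E <= xL M n b)%E ->
            purchase_cost M n x < VC M n x)),
      (forall n : nat, (n < N M)%N ->
        concave_function (VC M n) /\
        (0 < 1 - K M * dt M -> {homo VC M n : x y / x < y})) &
      (forall n : nat, (n < N M)%N -> exists! b : R, threshold M n b)].
Proof.
split=> [n nN x xHx|a0 n nN b thr|n nN|n nN].
- have le_next := VC_le_next_purchase M n x; split.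
    exact: le_trans le_next (next_purchase_le nN xHx).
  (* Strictness comes from the first comparison before the last period, and from the second one off
     the point [xH]. *)
  case=> [n1N|/eqP neq].
    exact: lt_le_trans (VC_lt_next_purchase x n1N) (next_purchase_le nN xHx).
  apply: le_lt_trans le_next (next_purchase_lt nN _).
  by rewrite lt_neqAle eq_sym neq.
- have Kdt0 := reversion_gt0 M.
  have a0' : 0 < 1 - dt M * K M by rewrite mulrC.
  have low x y : (x <= y / (dt M * K M)) = (x * (K M * dt M) <= y).
    by rewrite [dt M * _]mulrC ler_pdivlMr.
  have cE : theta M * dt M * K M = theta M * K M * dt M by ring.
  rewrite /xL cE; move: (thr); rewrite {1}/ext_threshold.
  case: ifP => [_ [b' bE _]|_ bE]; rewrite bE.
    (* For a finite next threshold, the first entry of the minimum says that the mean next price is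
       at most [b']. *)
    rewrite -EFinB -EFinM -EFin_min; split => // x.
    rewrite lee_fin le_min low ler_pdivlMr// => /andP[xb xK].
    apply: (VC_gt_purchase a0 nN thr) => //.
    by rewrite bE lee_fin; move: xb; lra.
  (* At the last decision time the first entry is [+oo], as [1 - dt K] is positive, and [xL] reduces
     to its second entry. *)
  rewrite addye// gt0_mulye ?lte_fin ?invr_gt0// minye; split => // x.
  rewrite lee_fin low => xK; apply: (VC_gt_purchase a0 nN thr) => //.
  by rewrite bE leey.
- split; first exact: concave_function_VC.
  by move=> a0; exact: VC_homo.
- exact: threshold_unique.
Qed.
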